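(* Let $n\ge 1$, let $\lambda=(\lambda_1,\dots,\lambda_n)\in\mathbb{C}^n$, and let $L(\lambda)$ be the simple highest weight $\mathfrak{gl}_n(\mathbb{C})$-module with highest weight $\lambda$. Put $l=\lambda+\rho=(l_1,\dots,l_n)$ with $l_i=\lambda_i+n-i$. Let $A$ be the multiset consisting of the last (i.e. the smallest) terms of the parts of the shuffle decomposition of the $n$-element sequence $l$. Then $A$ is the multiset of roots (counted with multiplicity) of the minimal polynomial of $L(\lambda)$.
   Context: The ground field is $\mathbb{C}$. The Lie algebra $\mathfrak{gl}_n$ has basis the matrix units $E_{ij}$, $1\le i,j\le n$, with $[E_{ij},E_{kl}]=\delta_{jk}E_{il}-\delta_{li}E_{kj}$. Triangular decomposition: $\mathfrak n^+$ is spanned by $E_{ij}$ with $i<j$, $\mathfrak n^-$ by $E_{ij}$ with $i>j$, and the Cartan subalgebra $\mathfrak h$ by $H_i=E_{ii}$; a weight $\lambda\in\mathfrak h^*$ is identified with the $n$-tuple $(\lambda_1,\dots,\lambda_n)$, $\lambda_i=\lambda(H_i)$. $L(\lambda)$ is the unique simple module generated by a vector $v_\lambda\neq0$ with $\mathfrak n^+v_\lambda=0$ and $H_iv_\lambda=\lambda_iv_\lambda$. Set $\rho=(n-1,n-2,\dots,0)$. Minimal polynomial. Let $E=(E_{ij})_{1\le i,j\le n}$ be the $n\times n$ matrix over $U(\mathfrak{gl}_n)$ whose $(i,j)$ entry is the generator $E_{ij}$; powers of $E$ are matrix powers over the noncommutative ring $U(\mathfrak{gl}_n)$. For a $\mathfrak{gl}_n$-module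 $V$, the minimal polynomial of $V$ is the nonzero monic polynomial $q\in\mathbb{C}[u]$ of minimal degree such that every entry of the matrix $q(E)$ acts by $0$ on $V$, i.e. the minimal polynomial of the image of $E$ in the matrix algebra $\mathrm{M}_n(\operatorname{End}V)$. Shuffle decomposition. A falling sequence is an arithmetic progression with step $-1$ (one-term sequences included). The shuffle decomposition of a finite sequence $l=(l_1,\dots,l_n)$ of complex numbers is a decomposition of $l$ into a disjoint union of falling subsequences, called its parts, constructed inductively. For the empty sequence it is empty. Given the shuffle decomposition of $l'=(l_1,\dots,l_{n-1})$, let $S$ be its longest part ending in $l_n+1$; the shuffle decomposition of $l$ is obtained by appending $l_n$ to the end of $S$ and leaving the other parts intact. If no such nonempty $S$ exists, a new part consisting of the single term $l_n$ is created. *)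

(* Defs.v *)
From HB Require Import structures.
From mathcomp Require Import all_boot all_order all_algebra.
From mathcomp Require Import boolp reals complex.

Set Implicit Arguments.
Unset Strict Implicit.
Unset Printing Implicit Defensive.

Import GRing.Theory.
Local Open Scope ring_scope.

Definition endo (K : fieldType) (V : lmodType K) : Type := {linear V -> V}.

(* End V, for V of arbitrary dimension, as a ring under composition
   ((f * g) v = f (g v)) and as a K-vector space. *)
Section Endo.
Variables (K : fieldType) (V : lmodType K).
Implicit Types f g h : endo V.

HB.instance Definition _ := gen_eqMixin (endo V).
HB.instance Definition _ := gen_choiceMixin (endo V).

Lemma endoP f g : (forall v, f v = g v) -> f = g.
Proof.
case: f g => [f cf] [g cg] /= /funext fg; case: _ / fg cg => cg {g}.
case: cf cg => [[fD] [fZ]] [[gD] [gZ]].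
by rewrite (Prop_irrelevance fD gD) (Prop_irrelevance fZ gZ).
Qed.

Definition endo0 : endo V := \0 : {linear V -> V}.
Definition endo1 : endo V := idfun : {linear V -> V}.
Definition endoN f : endo V := (\- f)%R : {linear V -> V}.
Definition endoD f g : endo V := (f \+ g)%R : {linear V -> V}.
Definition endoM f g : endo V := (f \o g) : {linear V -> V}.
Definition endoZ (a : K) f : endo V := (a \*: f)%R : {linear V -> V}.

Lemma endoDA : associative endoD.
Proof. by move=> f g h; apply: endoP => v /=; rewrite addrA. Qed.
Lemma endoDC : commutative endoD.
Proof. by move=> f g; apply: endoP => v /=; rewrite addrC. Qed.
Lemma endo0D : left_id endo0 endoD.
Proof. by move=> f; apply: endoP => v /=; rewrite add0r. Qed.
Lemma endoND : left_inverse endo0 endoN endoD.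
Proof. by move=> f; apply: endoP => v /=; rewrite addNr. Qed.

HB.instance Definition _ :=
  GRing.isZmodule.Build (endo V) endoDA endoDC endo0D endoND.

Lemma endoMA : associative endoM.
Proof. by move=> f g h; apply: endoP. Qed.
Lemma endo1M : left_id endo1 endoM.
Proof. by move=> f; apply: endoP. Qed.
Lemma endoM1 : right_id endo1 endoM.
Proof. by move=> f; apply: endoP. Qed.
Lemma endoMDl : left_distributive endoM +%R.
Proof. by move=> f g h; apply: endoP. Qed.
Lemma endoMDr : right_distributive endoM +%R.
Proof. by move=> f g h; apply: endoP => v /=; rewrite linearD. Qed.

HB.instance Definition _ :=
  GRing.Zmodule_isPzRing.Build (endo V) endoMA endo1M endoM1 endoMDl endoMDr.

Lemma endoZA a b f : endoZ a (endoZ b f) = endoZ (a * b) f.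
Proof. by apply: endoP => v /=; rewrite scalerA. Qed.
Lemma endo1Z : left_id 1 endoZ.
Proof. by move=> f; apply: endoP => v /=; rewrite scale1r. Qed.
Lemma endoZDr : right_distributive endoZ +%R.
Proof. by move=> a f g; apply: endoP => v /=; rewrite scalerDr. Qed.
Lemma endoZDl f : {morph endoZ^~ f : a b / a + b}.
Proof. by move=> a b; apply: endoP => v /=; rewrite scalerDl. Qed.

HB.instance Definition _ :=
  GRing.Zmodule_isLmodule.Build K (endo V) endoZA endo1Z endoZDr endoZDl.

End Endo.

Section GlModules.
Variables (K : fieldType) (n : nat) (V : lmodType K).
Variable rho : {linear 'M[K]_n -> endo V}.

(* gl_n is 'M[K]_n with the commutator bracket, E_ij being delta_mx i j. *)
Definition gl_representation :=
  forall A B : 'M[K]_n,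
    rho (A *m B - B *m A) = rho A * rho B - rho B * rho A.

(* By classical logic (asbool), boolean predicates are arbitrary subsets. *)
Definition gl_submodule (W : {pred V}) :=
  GRing.submod_closed W /\
  forall (A : 'M[K]_n) v, v \in W -> rho A v \in W.

Definition gl_simple :=
  (exists v : V, v != 0) /\
  forall W : {pred V}, gl_submodule W -> W =i pred1 0 \/ W =i predT.

Definition highest_weight_vector (lambda : 'I_n -> K) (v : V) :=
  [/\ v != 0,
      forall i j : 'I_n, (i < j)%N -> rho (delta_mx i j) v = 0 &
      forall i : 'I_n, rho (delta_mx i i) v = lambda i *: v].

Definition gl_generates (v : V) :=
  forall W : {pred V}, gl_submodule W -> v \in W -> W =i predT.

(* V is (a model of) L(lambda) *)
Definition simple_highest_weight (lambda : 'I_n -> K) :=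
  [/\ gl_representation, gl_simple &
      exists2 v, highest_weight_vector lambda v & gl_generates v].

(* The image in M_n(End V) of the matrix E over U(gl_n). *)
Definition gl_matrix : 'M[endo V]_n := \matrix_(i, j) rho (delta_mx i j).

(* q(E); the scalars of K act entrywise on M_n(End V). *)
Definition gl_matrix_eval (q : {poly K}) : 'M[endo V]_n :=
  \sum_(k < size q) map_mx (fun f : endo V => q`_k *: f) (gl_matrix ^+ k).

Definition gl_minimal_polynomial (q : {poly K}) :=
  [/\ q \is monic, gl_matrix_eval q = 0 &
      forall p : {poly K}, p \is monic -> gl_matrix_eval p = 0 ->
        (size q <= size p)%N].

End GlModules.

Section Shuffle.
Variable K : fieldType.

Definition ends_in (x : K) (s : seq K) := (s != [::]) && (last 0 s == x).

(* Parts ending in the same term and of the same length are equal as sequences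
   of values, so taking the first longest one does not affect the multiset of
   parts. *)
Definition shuffle_step (P : seq (seq K)) (x : K) : seq (seq K) :=
  let m := \max_(s <- P | ends_in (x + 1) s) size s in
  let k := find (fun s => ends_in (x + 1) s && (size s == m)) P in
  if (k < size P)%N then set_nth [::] P k (rcons (nth [::] P k) x)
  else rcons P [:: x].

Definition shuffle_decomposition (l : seq K) : seq (seq K) :=
  foldl shuffle_step [::] l.

Definition shuffle_ends (l : seq K) : seq K :=
  [seq last 0 s | s <- shuffle_decomposition l].

(* lambda + rho; indices start from 0, whence n - i.+1. *)
Definition shifted_weight (n : nat) (lambda : 'I_n -> K) : seq K :=
  [seq lambda i + (n - i.+1)%:R | i <- enum 'I_n].

Definition root_multiset (q : {poly K}) (A : seq K) :=
  forall a : K, mup a q = count_mem a A.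

End Shuffle.

(* Main.v *)
(* For every polynomial q, the diagonal entries of q(E) act on the highest weight
   vector v by scalars chi_i(q), and the entries above the diagonal annihilate v.
   An entry below the diagonal that does not annihilate v, taken as close to the
   diagonal as possible, would produce from v a singular vector of lower weight as
   soon as all chi_i(q) vanish, which is impossible in a simple module. Hence
   q(E) = 0 if and only if chi_i(q) = 0 for all i.

   The recursion chi_i(u q) = l_i chi_i(q) - sum_(j > i) chi_j(q) says that
   chi_i(q) is the value at l_i of the polynomial obtained from q by the successive
   steps g |-> g - (g - g(x)) / (u - x), for x = l_n, ..., l_(i+1). When
   g(x) = 0 such a step multiplies g by (u - x - 1) / (u - x). Consequently all
   chi_i(q) vanish if and only if for every a the multiplicity of a in q is at least
   #{j >= k : l_j = a} - #{j >= k : l_j = a - 1} for all k. The maximum over k of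
   these differences is the number of parts of the shuffle decomposition of l that
   end in a. *)

Require Import Defs.
From HB Require Import structures.
From mathcomp Require Import all_boot all_order all_algebra.
From mathcomp Require Import boolp reals complex.
From mathcomp Require Import zify ring.

Set Implicit Arguments.
Unset Strict Implicit.
Unset Printing Implicit Defensive.

Import Order.TTheory GRing.Theory Num.Theory.
Local Open Scope ring_scope.

(** * Counting the ends of the parts of the shuffle decomposition *)

Section ShuffleEnds.
Variable K : fieldType.
Implicit Types (x a : K) (l s : seq K) (P : seq (seq K)) (m : nat).

(** The maximum is attained, so the search in [shuffle_step] fails only when no part ends in
    [x + 1]. *)
Lemma has_longest P (p : pred (seq K)) :
  has p P -> has (fun s => p s && (size s == \max_(t <- P | p t) size t)) P.
Proof.
elim: P => //= s P IH; rewrite big_cons; case: (boolP (p s)) => /= ps; last exact: IH.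
have [hP|/hasPn nP] := boolP (has p P); move=> _.
  rewrite /maxn; case: ltnP => _; last by rewrite eqxx.
  by rewrite IH // orbT.
by rewrite big1_seq ?maxn0 ?eqxx // => t /andP[pt /nP]; rewrite pt.
Qed.

Lemma shuffle_step_nonempty P x :
  all (fun s => s != [::]) P -> all (fun s => s != [::]) (shuffle_step P x).
Proof.
move=> P0; rewrite /shuffle_step; set k := find _ P.
case: ltnP => hk; last by rewrite all_rcons P0.
apply/(all_nthP [::]) => i; rewrite size_set_nth (maxn_idPr hk) => hi.
rewrite nth_set_nth /=; case: (i =P k) => _; first by rewrite -size_eq0 size_rcons.
exact: (all_nthP [::] P0).
Qed.

(** Extending a part trades its end [x + 1] for [x], whatever its length. When no part ends in
    [x + 1], the subtraction truncates at zero, which matches the creation of a new part. *)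
Lemma count_ends_shuffle_step P x a :
  all (fun s => s != [::]) P ->
  count_mem a (map (last 0%R) (shuffle_step P x)) =
  ((x == a) + (count_mem a (map (last 0%R) P) - (a == x + 1)%R))%N.
Proof.
move=> P0; rewrite /shuffle_step; set p := fun s => _ && _; set k := find p P.
case: ltnP => hk.
  have hpk : p (nth [::] P k) by apply: nth_find; rewrite has_find.
  have hl : last 0 (nth [::] P k) = x + 1 by case/andP: hpk => /andP[_ /eqP].
  have -> : map (last 0%R) (set_nth [::] P k (rcons (nth [::] P k) x))
      = set_nth 0 (map (last 0%R) P) k x.
    apply: (@eq_from_nth _ 0) => [|i].
      by rewrite size_map !size_set_nth size_map.
    rewrite size_map => hi; rewrite (nth_map [::]) //.
    rewrite !nth_set_nth /=; case: eqP => [_|/eqP ik]; first by rewrite last_rcons.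
    rewrite (nth_map [::]) //; move: hi; rewrite size_set_nth.
    by rewrite (maxn_idPr hk).
  rewrite count_set_nth_ltn ?size_map //= (nth_map [::]) // hl (eq_sym (x + 1)%R).
  have : ((a == x + 1)%R <= count_mem a (map (last 0%R) P))%N.
    case: eqP => //= ->; rewrite -has_count has_map; apply/hasP.
    by exists (nth [::] P k); [exact: mem_nth | rewrite /= hl].
  by move=> h; rewrite addnC addnBA.
rewrite map_rcons /= -cats1 count_cat /= addn0 addnC; congr (_ + _)%N.
case: eqP => [ax|_]; last by rewrite subn0.
rewrite (@count_memPn _ _ _ _) //.
apply/mapP => -[s sP al].
move: hk; rewrite leqNgt -has_find; apply/negP; rewrite negbK.
apply: has_longest; apply/hasP; exists s => //.
by rewrite /ends_in -al ax eqxx andbT (allP P0).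
Qed.

(* A part ending in [a] is created by each term [a] and consumed by each term
   [a - 1], when there is one to consume; hence the maximum over the suffixes,
   as for the length of a queue. *)
Lemma count_ends_foldl_leq P l a m :
  all (fun s => s != [::]) P ->
  (count_mem a (map (last 0%R) (foldl (@shuffle_step K) P l)) <= m)%N <->
  (count_mem a (map (last 0%R) P) + count_mem a l <= m + count_mem (a - 1)%R l)%N /\
  forall k, (count_mem a (drop k l) <= m + count_mem (a - 1)%R (drop k l))%N.
Proof.
elim: l P => [|x l IH] P P0 /=; first by rewrite !addn0; split=> [|[]] //; lia.
have := IH _ (shuffle_step_nonempty x P0); rewrite count_ends_shuffle_step // => {}IH.
have xa : (a == x + 1)%R = (x == a - 1) by rewrite -subr_eq eq_sym.
have nb : (x == a) && (x == a - 1) = false.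
  apply/negP => /andP[/eqP -> /eqP/eqP].
  by rewrite eq_sym -subr_eq0 addrAC subrr sub0r oppr_eq0 oner_eq0.
split=> [/IH|] [h1 h2].
  have h0 := h2 0; rewrite drop0 in h0.
  split=> [|[|k]]; [|rewrite /=|exact: h2]; move: h1 h0 nb; rewrite xa;
    move: (count_mem a (map _ _)) (count_mem a l) (count_mem (a - 1) l) => c ca cb;
    by case: (x == a); case: (x == a - 1) => /=; lia.
apply/IH; split=> [|k]; last exact: (h2 k.+1).
(* The suffix [drop 1] serves the case where [x] is [a - 1] and no part ends in [a]: there the
   subtraction truncates. *)
move: h1 (h2 1) nb; rewrite /= drop0 xa.
move: (count_mem a (map _ _)) (count_mem a l) (count_mem (a - 1) l) => c ca cb.
by case: (x == a); case: (x == a - 1) => /=; lia.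
Qed.

Lemma count_shuffle_ends_leq l a m :
  (count_mem a (shuffle_ends l) <= m)%N <->
  forall k, (count_mem a (drop k l) <= m + count_mem (a - 1)%R (drop k l))%N.
Proof.
have := @count_ends_foldl_leq [::] l a m isT => /= h.
rewrite [shuffle_ends l]/shuffle_ends; split=> [/h[]//|hk].
by apply/h; split=> //; have := hk 0; rewrite drop0.
Qed.

End ShuffleEnds.

(** * Root multiplicities and the transfer of polynomials *)

Section Polynomials.
Variable K : fieldType.
Implicit Types (x a : K) (l s : seq K) (p q g : {poly K}).

Lemma mup_XsubC a x : mup a ('X - x%:P) = (x == a) :> nat.
Proof. by rewrite -[_ - _]expr1 mup_XsubCX; case: eqP. Qed.

Lemma prod_XsubC_dvdp l q : q != 0 ->
  (forall a, (count_mem a l <= mup a q)%N) -> \prod_(a <- l) ('X - a%:P) %| q.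
Proof.
elim: l q => [|x l IH] q q0 h; first by rewrite big_nil dvd1p.
have /dvdpP[g eqg] : 'X - x%:P %| q.
  by rewrite XsubC_dvd // (leq_trans _ (h x)) //= eqxx.
have g0 : g != 0 by apply: contraNneq q0; rewrite eqg => ->; rewrite mul0r.
rewrite big_cons eqg mulrC dvdp_mul2r ?polyXsubC_eq0 //; apply: IH => // a.
by have := h a; rewrite eqg mupM ?polyXsubC_eq0 //= mup_XsubC; lia.
Qed.

Lemma mup_prod_XsubC l a :
  mup a (\prod_(b <- l) ('X - b%:P)) = count_mem a l.
Proof.
elim: l => [|x l IH]; first by rewrite big_nil mupNroot ?root1.
rewrite big_cons mupM ?polyXsubC_eq0 // ?IH ?mup_XsubC //.
by rewrite monic_neq0 // monic_prod_XsubC.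
Qed.

(* When [x] is a root of [g], this is [g * (X - x - 1) / (X - x)]. *)
Definition transfer x g := g - (g - g.[x]%:P) %/ ('X - x%:P).

(* The scalars by which the diagonal entries of [q(E)] act on a highest weight
   vector, [l] being the shifted highest weight. *)
Definition diag_scalar l q i := (foldr transfer q (drop i.+1 l)).[l`_i].

Lemma transferD x p q : transfer x (p + q) = transfer x p + transfer x q.
Proof.
rewrite /transfer hornerD polyCD.
have -> : p + q - (p.[x]%:P + q.[x]%:P) = (p - p.[x]%:P) + (q - q.[x]%:P) by ring.
by rewrite divpD; ring.
Qed.

Lemma transferC x a : transfer x a%:P = a%:P.
Proof. by rewrite /transfer hornerC subrr div0p subr0. Qed.

(** If [g - g(x)] is [h * (X - x)], then the quotient for [g * X] is [h * X + g(x)]. *)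
Lemma transferMX x g : transfer x (g * 'X) = transfer x g * 'X - g.[x]%:P.
Proof.
rewrite /transfer hornerM hornerX polyCM.
have /dvdpP[h eh] : 'X - x%:P %| g - g.[x]%:P.
  by rewrite dvdp_XsubCl rootE !hornerE subrr.
have -> : g * 'X - g.[x]%:P * x%:P = (h * 'X + g.[x]%:P) * ('X - x%:P).
  by rewrite mulrDl mulrAC -eh; ring.
by rewrite eh !mulpK ?polyXsubC_eq0 //; ring.
Qed.

Lemma transfer_factor x g :
  transfer x (g * ('X - x%:P)) = g * ('X - (x + 1)%:P).
Proof.
rewrite /transfer !hornerE subrr mulr0 subr0 mulpK ?polyXsubC_eq0 //.
by rewrite polyCD; ring.
Qed.

Lemma foldr_transferD l p q :
  foldr transfer (p + q) l = foldr transfer p l + foldr transfer q l.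
Proof. by elim: l => //= x l ->; rewrite transferD. Qed.

Lemma foldr_transferC l a : foldr transfer a%:P l = a%:P.
Proof. by elim: l => //= x l ->; rewrite transferC. Qed.

(** Downward induction on [i]: the transfer at [l_j] leaves behind the constant
    [- diag_scalar l g j], which the later transfers fix. *)
Lemma foldr_transferMX l g i : (i <= size l)%N ->
  foldr transfer (g * 'X) (drop i l) =
  foldr transfer g (drop i l) * 'X
    - (\sum_(i <= j < size l) diag_scalar l g j)%:P.
Proof.
move=> hi; have [m em] : {m | size l - i = m}%N by exists (size l - i)%N.
elim: m i hi em => [|m IH] i hi em.
  by rewrite drop_oversize ?big_geq ?subr0 //=; lia.
have hi' : (i < size l)%N by lia.
have em' : (size l - i.+1)%N = m by lia.
rewrite (drop_nth 0 hi') ![foldr _ _ (_ :: _)]/= (IH i.+1 hi' em') (big_ltn hi').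
rewrite transferD transferMX -[X in _ + transfer _ X]polyCN transferC.
rewrite polyCN polyCD /diag_scalar; ring.
Qed.

Lemma diag_scalarD l p q i :
  diag_scalar l (p + q) i = diag_scalar l p i + diag_scalar l q i.
Proof. by rewrite /diag_scalar foldr_transferD hornerD. Qed.

Lemma diag_scalarC l a i : diag_scalar l a%:P i = a.
Proof. by rewrite /diag_scalar foldr_transferC hornerC. Qed.

Lemma diag_scalarMX l q i : (i < size l)%N ->
  diag_scalar l (q * 'X) i =
  l`_i * diag_scalar l q i - \sum_(i.+1 <= j < size l) diag_scalar l q j.
Proof.
by move=> hi; rewrite {1}/diag_scalar foldr_transferMX // !hornerE mulrC.
Qed.

Lemma diag_scalar_eq0 l q : q != 0 ->
  (forall i, (i < size l)%N -> diag_scalar l q i = 0) <->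
  (forall a, (count_mem a (shuffle_ends l) <= mup a q)%N).
Proof.
move=> q0.
have main s : (forall i, (i < size s)%N -> diag_scalar s q i = 0) <->
    (forall a k, (count_mem a (drop k s)
                  <= mup a q + count_mem (a - 1)%R (drop k s))%N).
  (* The induction also carries the multiplicities in the transferred polynomial. They are known
     exactly while all scalars vanish, since each transfer then trades a root [x] for [x + 1]. *)
  suff [h _] : ((forall i, (i < size s)%N -> diag_scalar s q i = 0) <->
    (forall a k, (count_mem a (drop k s)
                  <= mup a q + count_mem (a - 1)%R (drop k s))%N)) /\
    ((forall i, (i < size s)%N -> diag_scalar s q i = 0) ->
       foldr transfer q s != 0 /\ forall a,
       (mup a (foldr transfer q s) + count_mem a s
         = mup a q + count_mem (a - 1)%R s)%N) by [].
  elim: s => [|x s [IH1 IH2]].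
    by split=> // _; split=> // a; rewrite !addn0.
  have e0 : diag_scalar (x :: s) q 0 = (foldr transfer q s).[x].
    by rewrite /diag_scalar /= drop0.
  have shift : (forall i, (i < size (x :: s))%N -> diag_scalar (x :: s) q i = 0)
      <-> diag_scalar (x :: s) q 0 = 0 /\
          (forall i, (i < size s)%N -> diag_scalar s q i = 0).
    split=> [h|[h0 h] [|i] //]; last exact: h.
    by split=> [|i]; [exact: h | exact: (h i.+1)].
  split; last first.
    case/shift; rewrite e0 => /eqP hx /IH2[g0 hm].
    move: g0 hm; set g := foldr _ _ _ => g0 hm.
    have /dvdpP[h eh] : 'X - x%:P %| g by rewrite dvdp_XsubCl.
    have h0 : h != 0 by apply: contraNneq g0; rewrite eh => ->; rewrite mul0r.
    rewrite /= -/g eh transfer_factor; split.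
      by rewrite mulf_neq0 ?polyXsubC_eq0.
    move=> a; have := hm a.
    rewrite eh !mupM ?polyXsubC_eq0 // !mup_XsubC.
    have -> : (x + 1 == a) = (x == a - 1) by rewrite eq_sym -subr_eq eq_sym.
    move: (mup a h) (mup a q) (count_mem a s) (count_mem _ s) => ? ? ? ?.
    by case: (x == a); case: (x == a - 1) => /=; lia.
  have nb : (x == x - 1) = false.
    by rewrite -subr_eq0 opprB addrC subrK oner_eq0.
  rewrite shift; split=> [[] hx hs a [|k]|h].
  (* For the whole list the only new constraint is at [a = x]: it says that [x] is a root of the
     transferred polynomial. *)
  - have [g0 /(_ a)] := IH2 hs; have /IH1/(_ a 0) := hs; rewrite drop0 /=.
    case: eqP => [<-|_]; last by lia.
    move=> _; have : (0 < mup x (foldr transfer q s))%N.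
      by rewrite -XsubC_dvd // dvdp_XsubCl rootE -e0 hx.
    by lia.
  - by have /IH1 := hs; apply.
  have hs : forall i, (i < size s)%N -> diag_scalar s q i = 0.
    by apply/IH1 => a k; exact: (h a k.+1).
  split=> //; have [g0 /(_ x) hm] := IH2 hs.
  apply/eqP; rewrite e0 -rootE -dvdp_XsubCl XsubC_dvd //.
  move: (h x 0) hm; rewrite /= nb eqxx; move: (mup x _) (count_mem x s) => a b.
  by move: (mup x q) (count_mem _ s) => c d; lia.
rewrite main; split=> h a; first by apply/count_shuffle_ends_leq.
exact/count_shuffle_ends_leq.
Qed.

End Polynomials.

(** * Pointwise rules for endomorphisms *)

Section EndoTheory.
Variables (K : fieldType) (V : lmodType K).
Implicit Types f g : endo V.

Lemma endo_sumE (I : Type) (r : seq I) (P : pred I) (F : I -> endo V) v :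
  (\sum_(i <- r | P i) F i) v = \sum_(i <- r | P i) F i v.
Proof. by elim/big_rec2: _ => // i w f _ <-. Qed.

Lemma endo_mulE f g v : (f * g) v = f (g v). Proof. by []. Qed.

Lemma endo_addE f g v : (f + g) v = f v + g v. Proof. by []. Qed.

Lemma endo_scale1E a v : (a *: (1 : endo V)) v = a *: v. Proof. by []. Qed.

Lemma endo_scalerAl a f g : (a *: f) * g = a *: (f * g).
Proof. exact: endoP. Qed.

Lemma endo_scalerAr a f g : f * (a *: g) = a *: (f * g).
Proof. by apply: endoP => v; rewrite /= linearZ. Qed.

End EndoTheory.

(** * Polynomials in the matrix [E] and the adjoint action *)

Section GlEval.
Variables (K : fieldType) (n : nat) (V : lmodType K).
Variable rho : {linear 'M[K]_n -> endo V}.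
Implicit Types (A : 'M[K]_n) (p q : {poly K}) (i j : 'I_n) (v w : V).

Lemma gl_matrix_eval_wide q m : (size q <= m)%N ->
  gl_matrix_eval rho q =
  \sum_(k < m) map_mx (fun f : endo V => q`_k *: f) (gl_matrix rho ^+ k).
Proof.
move=> qm; rewrite /gl_matrix_eval.
rewrite (big_ord_widen m (fun k : nat => map_mx (fun f : endo V => q`_k *: f)
  (gl_matrix rho ^+ k))) // big_mkcond; apply: eq_bigr => k _.
case: ltnP => // qk; apply/matrixP => i j.
by rewrite !mxE nth_default // scale0r.
Qed.

Lemma gl_matrix_evalD p q i j : gl_matrix_eval rho (p + q) i j =
  gl_matrix_eval rho p i j + gl_matrix_eval rho q i j.
Proof.
pose m := maxn (size p) (size q).
rewrite (@gl_matrix_eval_wide _ m) ?size_polyD // (@gl_matrix_eval_wide p m) ?leq_maxl //.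
rewrite (@gl_matrix_eval_wide q m) ?leq_maxr // !summxE -big_split.
by apply: eq_bigr => k _; rewrite !mxE coefD scalerDl.
Qed.

Lemma gl_matrix_evalC a i j :
  gl_matrix_eval rho a%:P i j = a *: (1 : endo V) *+ (i == j).
Proof.
rewrite (@gl_matrix_eval_wide _ 1) ?size_polyC_leq1 // big_ord1 !mxE coefC.
by rewrite scalerMnr.
Qed.

Lemma gl_matrix_evalMX q i j : gl_matrix_eval rho (q * 'X) i j =
  \sum_m rho (delta_mx i m) * gl_matrix_eval rho q m j.
Proof.
rewrite (@gl_matrix_eval_wide _ (size q).+1) ?size_polyMX_leq //; last first.
  by rewrite (leq_trans (size_polyMleq _ _)) // size_polyX; lia.
rewrite big_ord_recl mxE [X in X + _]mxE coefMX /= scale0r add0r.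
under [RHS]eq_bigr => m _ do rewrite summxE mulr_sumr.
rewrite exchange_big summxE; apply: eq_bigr => k _.
rewrite !mxE coefMX /= exprS mxE scaler_sumr; apply: eq_bigr => m _.
by rewrite !mxE endo_scalerAr.
Qed.

Hypothesis hrep : gl_representation rho.

(* The adjoint action of [A] on a matrix of operators that transforms like [E]
   is the commutator with this matrix. *)
Let adjoint_mx A : 'M[endo V]_n :=
  (rho A)%:M - map_mx (fun a : K => a *: (1 : endo V)) A^T.

Lemma adjoint_mulmx A (X : 'M[endo V]_n) i j : (adjoint_mx A *m X) i j =
  rho A * X i j - \sum_k A k i *: X k j.
Proof.
rewrite mulmxBl mul_scalar_mx !mxE; congr (_ - _).
by apply: eq_bigr => k _; rewrite !mxE endo_scalerAl mul1r.
Qed.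

Lemma mulmx_adjoint A (X : 'M[endo V]_n) i j : (X *m adjoint_mx A) i j =
  X i j * rho A - \sum_k A j k *: X i k.
Proof.
rewrite mulmxBr !mxE; congr (_ - _).
  rewrite (bigD1 j) //= big1 ?addr0 => [|k kj]; rewrite mxE ?eqxx //.
  by rewrite (negbTE kj) mulr0.
by apply: eq_bigr => k _; rewrite !mxE endo_scalerAr mulr1.
Qed.

(** This is the bracket of [A] with [E_ij]; as a commutation in the matrix ring it passes to powers
    at once. *)
Lemma gl_matrix_comm A : GRing.comm (adjoint_mx A) (gl_matrix rho).
Proof.
apply/matrixP => i j; rewrite adjoint_mulmx mulmx_adjoint !mxE.
have := hrep A (delta_mx i j).
have -> : A *m delta_mx i j = \sum_k A k i *: delta_mx k j.
  apply/matrixP => a b; rewrite mxE summxE (bigD1 i) //= big1 => [|k ki].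
    rewrite (bigD1 a) //= big1 => [|k ka]; rewrite !mxE ?eqxx //.
    by rewrite eq_sym (negbTE ka) mulr0.
  by rewrite mxE (negbTE ki) mulr0.
have -> : delta_mx i j *m A = \sum_k A j k *: delta_mx i k.
  apply/matrixP => a b; rewrite mxE summxE (bigD1 j) //= big1 => [|k kj].
    rewrite (bigD1 b) //= big1 => [|k kb]; rewrite !mxE ?eqxx ?andbT.
      by rewrite mulrC.
    by rewrite (eq_sym b) (negbTE kb) andbF mulr0.
  by rewrite mxE (negbTE kj) andbF mul0r.
have rhoZ (a : 'I_n -> K) (F : 'I_n -> 'M[K]_n) :
    rho (\sum_k a k *: F k) = \sum_k a k *: rho (F k).
  by rewrite linear_sum; apply: eq_bigr => k _; rewrite linearZ.
rewrite linearB !rhoZ => h.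
under eq_bigr do rewrite mxE; under [in RHS]eq_bigr do rewrite mxE.
move/(canRL (subrK _)): h => ->.
by rewrite opprD opprB !addrA [X in X - _ - _]addrC addrK.
Qed.

Lemma gl_matrix_eval_adjoint A q :
  GRing.comm (adjoint_mx A) (gl_matrix_eval rho q).
Proof.
apply: commr_sum => k _.
have /matrixP h := commrX k (gl_matrix_comm A).
apply/matrixP => i j; have := congr1 (fun f : endo V => q`_k *: f) (h i j).
rewrite !mxE !scaler_sumr => e; under eq_bigr do rewrite [X in _ * X]mxE endo_scalerAr.
by rewrite e; apply: eq_bigr => m _; rewrite [X in _ = X * _]mxE endo_scalerAl.
Qed.

(** The entries of [q(E)] transform under [gl_n] like the [E_ij] themselves. *)
Lemma gl_matrix_eval_comm A q i j v :
  rho A (gl_matrix_eval rho q i j v) =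
  gl_matrix_eval rho q i j (rho A v)
  + \sum_k A k i *: gl_matrix_eval rho q k j v
  - \sum_k A j k *: gl_matrix_eval rho q i k v.
Proof.
have /matrixP/(_ i j) := gl_matrix_eval_adjoint A q.
rewrite adjoint_mulmx mulmx_adjoint => /(congr1 (fun f : endo V => f v)) /= e.
by rewrite (canRL (subrK _) e) !endo_sumE addrAC.
Qed.

Lemma gl_matrix_eval_comm_delta q k l i j v :
  rho (delta_mx k l) (gl_matrix_eval rho q i j v) =
  gl_matrix_eval rho q i j (rho (delta_mx k l) v)
  + gl_matrix_eval rho q k j v *+ (l == i)
  - gl_matrix_eval rho q i l v *+ (k == j).
Proof.
rewrite gl_matrix_eval_comm; congr (_ + _ - _).
  rewrite (bigD1 k) //= big1 => [|m mk]; rewrite !mxE.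
    by rewrite eqxx eq_sym addr0; case: eqP; rewrite ?scale1r ?scale0r.
  by rewrite (negbTE mk) scale0r.
rewrite (bigD1 l) //= big1 => [|m ml]; rewrite !mxE.
  by rewrite eqxx eq_sym andbT addr0; case: eqP; rewrite ?scale1r ?scale0r.
by rewrite (negbTE ml) andbF scale0r.
Qed.

End GlEval.

(** * Action of [q(E)] on a highest weight vector *)

Section HighestWeight.
Variables (K : fieldType) (n : nat) (V : lmodType K).
Variable rho : {linear 'M[K]_n -> endo V}.
Hypothesis hrep : gl_representation rho.
Variables (lambda : 'I_n -> K) (v : V).
Hypothesis hv : highest_weight_vector rho lambda v.
Implicit Types (p q : {poly K}) (i j : 'I_n).

Local Notation E i j := (rho (delta_mx i j)).
Local Notation M q := (gl_matrix_eval rho q).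
Local Notation l := (shifted_weight lambda).

Lemma size_shifted_weight : size l = n.
Proof. by rewrite size_map size_enum_ord. Qed.

Lemma nth_shifted_weight i : l`_i = lambda i + (n - i.+1)%:R.
Proof. by rewrite (nth_map i) ?size_enum_ord // nth_ord_enum. Qed.

(** Induction on [q] through [E * q(E)]. If [m < j] the induction hypothesis applies; otherwise
    [E_im] is a raising operator and is moved to [v], the commutator terms being zero by induction
    or because [i] differs from [j]. *)
Lemma gl_matrix_eval_upper q i j : (i < j)%N -> M q i j v = 0.
Proof.
case: hv => _ raise _.
elim/poly_ind: q i j => [|q c IH] i j ij.
  by rewrite /gl_matrix_eval size_poly0 big_ord0 mxE.
rewrite gl_matrix_evalD gl_matrix_evalMX gl_matrix_evalC -val_eqE (ltn_eqF ij).
rewrite mulr0n addr0 endo_sumE big1 // => m _.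
rewrite endo_mulE.
have [mj|jm] := ltnP m j; first by rewrite IH // linear0.
have im := leq_trans ij jm.
rewrite gl_matrix_eval_comm_delta // raise // linear0 add0r eqxx mulr1n IH //.
by rewrite -val_eqE (ltn_eqF ij) mulr0n subr0.
Qed.

(** In the sum for [E * q(E)], the terms [m < i] vanish, [m = i] brings in [lambda i], and each
    [m > i] gives a difference of two scalars by commutation. *)
Lemma gl_matrix_eval_diag q i : M q i i v = diag_scalar l q i *: v.
Proof.
case: hv => _ raise cartan.
elim/poly_ind: q i => [|q c IH] i.
  by rewrite /gl_matrix_eval size_poly0 big_ord0 mxE diag_scalarC scale0r.
rewrite gl_matrix_evalD gl_matrix_evalMX gl_matrix_evalC eqxx mulr1n.
rewrite diag_scalarD diag_scalarC scalerDl.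
rewrite endo_addE endo_scale1E; congr (_ + _).
rewrite diag_scalarMX ?size_shifted_weight // big_geq_mkord endo_sumE.
under eq_bigr do rewrite endo_mulE.
rewrite (bigID (fun m : 'I_n => (i < m)%N)) /= [X in _ + X](bigD1 i) ?ltnn //=.
rewrite [X in _ + (_ + X)]big1 ?addr0 => [|m /andP[mi mni]]; last first.
  rewrite gl_matrix_eval_upper ?linear0 //.
  by move: mi mni; rewrite -val_eqE /=; lia.
rewrite IH linearZ /= cartan scalerA.
rewrite (eq_bigr (fun m : 'I_n => (diag_scalar l q i - diag_scalar l q m) *: v)).
  rewrite -scaler_suml -scalerDl; congr (_ *: _).
  (* The [n - i.+1] indices above [i] account for the shift from [lambda i] to [l_i]. *)
  rewrite sumrB -(big_geq_mkord i.+1 n xpredT (fun=> diag_scalar l q i)).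
  by rewrite big_const_nat iter_addr_0 nth_shifted_weight -[_ *+ _]mulr_natl; ring.
move=> m im; rewrite gl_matrix_eval_comm_delta //.
by rewrite raise // linear0 add0r !eqxx !mulr1n !IH scalerBl.
Qed.

End HighestWeight.

(** * Singular vectors of lower weight in a simple module *)

Section Singular.
Variables (K : numFieldType) (n : nat) (V : lmodType K).
Variable rho : {linear 'M[K]_n -> endo V}.
Hypothesis hrep : gl_representation rho.
Implicit Types (i j : 'I_n) (A B : 'M[K]_n) (mu : 'I_n -> K) (u v w : V) (s : seq K) (c : K).

Local Notation E i j := (rho (delta_mx i j)).

(** This is [U(n^-) w], given by closure rules instead of the enveloping algebra. *)
Inductive lowered w : V -> Prop :=
| Lowered_self : lowered w w
| Lowered_lin a u u' : lowered w u -> lowered w u' -> lowered w (a *: u + u')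
| Lowered_step i j u : (j < i)%N -> lowered w u -> lowered w (E i j u).

Lemma lowered0 w : lowered w 0.
Proof.
by rewrite -(addNr w) -scaleN1r; apply: Lowered_lin; exact: Lowered_self.
Qed.

Lemma rho_comm A B u : rho A (rho B u) = rho B (rho A u) + rho (A *m B - B *m A) u.
Proof.
have /(congr1 (fun f : endo V => f u)) := hrep A B => ->.
by rewrite endo_addE endo_mulE [X in _ + (_ + X)]/(- rho B (rho A u)) addrC subrK.
Qed.

(** Moving [A] past a lowering operator costs a commutator, again an element of [gl_n], to which the
    same induction hypothesis applies. *)
Lemma lowered_stable mu w :
  (forall i j, (i < j)%N -> E i j w = 0) ->
  (forall i, E i i w = mu i *: w) ->
  forall A u, lowered w u -> lowered w (rho A u).
Proof.
move=> raise cartan A u hu; elim: hu A => {u} [|a u u' _ IH _ IH'|i j u ji hu IH] A.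
- rewrite [A]matrix_sum_delta linear_sum endo_sumE.
  elim/big_ind: _ => [|x y hx hy|i _]; first exact: lowered0.
    by rewrite -[x]scale1r; apply: Lowered_lin.
  rewrite linear_sum endo_sumE.
  elim/big_ind: _ => [|x y hx hy|j _]; first exact: lowered0.
    by rewrite -[x]scale1r; apply: Lowered_lin.
  have sc a z : lowered w z -> lowered w (a *: z).
    by move=> hz; rewrite -[_ *: _]addr0; apply: Lowered_lin => //; exact: lowered0.
  rewrite linearZ; apply: (sc (A i j) (E i j w)).
  have [/raise ->|ji|/val_inj <-] := ltngtP i j; first exact: lowered0.
    by apply: Lowered_step => //; exact: Lowered_self.
  by rewrite cartan; apply: sc; exact: Lowered_self.
- by rewrite linearP; apply: Lowered_lin.
rewrite rho_comm -[rho (delta_mx i j) _]scale1r; apply: Lowered_lin => //.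
exact: Lowered_step.
Qed.

(* Lowering operators shift the eigenvalues of [grading] by negative integers. *)
Let grading : endo V := rho (diag_mx (\row_i - (i%:R : K))).

Definition grade mu : K := \sum_(i < n) - i%:R * mu i.

Lemma grading_weight mu w :
  (forall i, E i i w = mu i *: w) -> grading w = grade mu *: w.
Proof.
move=> cartan; rewrite /grading diag_mx_sum_delta linear_sum endo_sumE scaler_suml.
apply: eq_bigr => i _; rewrite linearZ mxE -scalerA -cartan; exact: erefl.
Qed.

Lemma grading_lower i j u :
  grading (E i j u) = E i j (grading u) + (j%:R - i%:R) *: E i j u.
Proof.
rewrite /grading rho_comm; congr (_ + _).
have -> : diag_mx (\row_i0 - i0%:R) *m delta_mx i j
    - delta_mx i j *m diag_mx (\row_i0 - i0%:R)
    = (j%:R - i%:R) *: delta_mx i j :> 'M[K]_n.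
  apply/matrixP => a b; rewrite mul_diag_mx mul_mx_diag !mxE.
  by case: (eqVneq a i) => [->|_]; case: (eqVneq b j) => [->|_] /=; ring.
by rewrite linearZ.
Qed.

Let annihilator s : endo V := \prod_(a <- s) (grading - a *: (1 : endo V)).

(** Sums of generalized eigenvectors of [grading] with eigenvalues outside [c + N], encoded by a
    killing product so that no eigenvector decomposition is needed. *)
Definition below c u :=
  exists2 s, (forall m, c + m%:R \notin s) & annihilator s u = 0.

Lemma annihilator_cons a s u :
  annihilator (a :: s) u = grading (annihilator s u) - a *: annihilator s u.
Proof. by rewrite /annihilator big_cons. Qed.

Lemma annihilator_cat s t : annihilator (s ++ t) = annihilator s * annihilator t.
Proof. by rewrite /annihilator big_cat. Qed.

Lemma annihilatorC s t : annihilator s * annihilator t = annihilator t * annihilator s.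
Proof.
apply: commr_prod => a _; apply/commr_sym/commr_prod => b _.
have sc (x : K) (f : endo V) : GRing.comm f (x *: (1 : endo V)).
  by rewrite /GRing.comm endo_scalerAr endo_scalerAl mulr1 mul1r.
apply: commrB => //; apply/commr_sym/commrB => //; exact/commr_sym.
Qed.

Lemma below_lin c a u u' : below c u -> below c u' -> below c (a *: u + u').
Proof.
case=> s hs su [t ht tu]; exists (s ++ t) => [m|].
  by rewrite mem_cat negb_or hs ht.
by rewrite linearP annihilator_cat {1}annihilatorC !endo_mulE su tu !linear0 addr0.
Qed.

Lemma below_lower c i j u : (j < i)%N -> below c u -> below c (E i j u).
Proof.
move=> ji [s hs su]; pose d : K := i%:R - j%:R.
exists [seq a - d | a <- s] => [m|].
  apply/mapP => -[a sa ea].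
  (* As [j < i], the natural difference is exact, and a shifted root in [c + N] comes from a root
     already in [c + N]. *)
  have /negP := hs (m + (i - j))%N; apply.
  by rewrite natrD natrB 1?ltnW // addrA ea /d subrK.
suff -> : annihilator [seq a - d | a <- s] (E i j u) = E i j (annihilator s u).
  by rewrite su linear0.
elim: s {hs su} => [|a s IH] /=; first by rewrite /annihilator !big_nil.
have lin x y : E i j (x - a *: y) = E i j x - a *: E i j y.
  by rewrite linearB linearZ.
rewrite !annihilator_cons IH grading_lower lin -addrA -scalerBl -[in RHS]scaleNr.
by congr (_ + _ *: _); rewrite /d; ring.
Qed.

(** If [w] were nonzero, simplicity would put [v] into [U(n^-) w], where the eigenvalues of
    [grading] avoid [grade lambda + N]; but [v] has eigenvalue [grade lambda]. *)
Lemma singular_vector_eq0 (lambda mu : 'I_n -> K) v w d :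
  gl_simple rho -> v != 0 -> (forall i, E i i v = lambda i *: v) ->
  (forall i j, (i < j)%N -> E i j w = 0) ->
  (forall i, E i i w = mu i *: w) ->
  grade mu = grade lambda - d.+1%:R -> w = 0.
Proof.
move=> [_ simple] v0 hv raise hw hd.
pose W : {pred V} := fun u => `[< lowered w u >].
have WE u : reflect (lowered w u) (u \in W) by exact: asboolP.
have [|W0|WT] := simple W.
- split=> [|A u /WE hu]; last exact/WE/(lowered_stable raise hw).
  split=> [|a x y /WE hx /WE hy]; first exact/WE/lowered0.
  by apply/WE/Lowered_lin.
- by apply/eqP; have := W0 w; rewrite [RHS]inE => <-; apply/WE/Lowered_self.
have lowerP u : lowered w u -> below (grade lambda) u.
  elim=> {u} [|a u u' _ IH _ IH'|i j u ji _ IH].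
  - exists [:: grade mu] => [m|]; last first.
      by rewrite annihilator_cons /annihilator big_nil (grading_weight hw) subrr.
    (* By characteristic zero, [grade lambda - d.+1] is not of the form [grade lambda + m]. *)
    rewrite inE hd -subr_eq0 opprB addrC addrA subrK.
    by rewrite -natrD pnatr_eq0.
  - exact: below_lin.
  - exact: below_lower.
have [s hs] : below (grade lambda) v by apply/lowerP/WE; rewrite WT.
suff -> : annihilator s v = \prod_(a <- s) (grade lambda - a) *: v.
  move/eqP; rewrite scaler_eq0 (negbTE v0) orbF prodf_seq_eq0 => /hasP[a sa].
  by rewrite /= subr_eq0 => /eqP ea; have := hs 0; rewrite addr0 ea sa.
elim: s {hs} => [|a s IH]; first by rewrite /annihilator !big_nil scale1r.
rewrite annihilator_cons IH big_cons linearZ /= (grading_weight hv) !scalerA -scalerBl.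
by congr (_ *: _); ring.
Qed.

End Singular.

(** * The minimal polynomial of [L(lambda)] *)

Section MinimalPolynomial.
Variables (K : numFieldType) (n : nat) (V : lmodType K).
Variable rho : {linear 'M[K]_n -> endo V}.
Variable lambda : 'I_n -> K.
Hypothesis hL : simple_highest_weight rho lambda.
Implicit Types (p q : {poly K}) (i j : 'I_n).

Local Notation E i j := (rho (delta_mx i j)).
Local Notation M q := (gl_matrix_eval rho q).
Local Notation l := (shifted_weight lambda).

(* By induction on [i - j], each [M q i j v] is singular of weight lower than that
   of [v]. *)
Lemma gl_matrix_eval_hwv_eq0 q v : highest_weight_vector rho lambda v ->
  (forall i, diag_scalar l q i = 0) -> forall i j, M q i j v = 0.
Proof.
case: hL => hrep hsimple _ hv diag0.
have upper i j : (i <= j)%N -> M q i j v = 0.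
  rewrite leq_eqVlt => /orP[/eqP/val_inj <-|]; last exact: (gl_matrix_eval_upper hrep hv).
  by rewrite (gl_matrix_eval_diag hrep hv) diag0 scale0r.
case: (hv) => v0 raise cartan.
suff lower d i j : (i <= j + d)%N -> M q i j v = 0.
  by move=> i j; apply: (lower i); rewrite leq_addl.
elim: d i j => [|d IH] i j; first by rewrite addn0; exact: upper.
rewrite addnS leq_eqVlt ltnS => /orP[/eqP ij|]; last exact: IH.
(* The weight of [M q i j v], which has the same shift as that of [E_ij]. *)
pose mu k := lambda k + (k == i)%:R - (k == j)%:R.
apply: (@singular_vector_eq0 _ _ _ _ hrep lambda mu v _ d) => // [a b ab|a|].
- rewrite gl_matrix_eval_comm_delta // raise // linear0 add0r.
  (* As [a < b], each commutator term that can occur is an entry at most [d] below the diagonal, so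
     the induction hypothesis kills it. *)
  have -> : M q a j v *+ (b == i) = 0.
    by case: eqP => //= bi; apply: IH; rewrite -ltnS -ij -bi.
  case: eqP => [aj|_]; rewrite ?subrr //= mulr1n IH ?subrr //.
  by rewrite -ltnS -addSn ij -addnS; move: ab; rewrite aj; lia.
- rewrite gl_matrix_eval_comm_delta // cartan linearZ /= /mu scalerBl scalerDl.
  by congr (_ + _ - _); case: eqP => [<-|_]; rewrite ?scale1r ?scale0r.
rewrite /grade /mu.
under eq_bigr do rewrite mulrBr mulrDr.
have sum1 i' : \sum_(k < n) - k%:R * (k == i')%:R = - i'%:R :> K.
  rewrite (bigD1 i') //= big1 ?addr0 ?eqxx ?mulr1 // => k /negbTE ->.
  by rewrite mulr0.
by rewrite sumrB big_split /= !sum1 ij -addnS natrD; ring.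
Qed.

Lemma gl_matrix_eval_eq0 q : q != 0 ->
  M q = 0 <-> forall a, (count_mem a (shuffle_ends l) <= mup a q)%N.
Proof.
move=> q0; rewrite -diag_scalar_eq0 // size_shifted_weight.
case: (hL) => hrep hsimple [v hv gen].
split=> [Mq0 i hi|diag0].
  case: (hv) => v0 _ _; have := gl_matrix_eval_diag hrep hv q (Ordinal hi).
  rewrite Mq0 mxE /= => /esym/eqP; rewrite scaler_eq0 (negbTE v0) orbF.
  by move/eqP.
(* The common kernel of the entries is a submodule by [gl_matrix_eval_comm], so it suffices that it
   contains the generator [v]. *)
pose W : {pred V} := fun u => `[< forall i j, M q i j u = 0 >].
have WE u : reflect (forall i j, M q i j u = 0) (u \in W) by exact: asboolP.
have hW : gl_submodule rho W.
  split=> [|A u /WE hu].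
    split=> [|a x y /WE hx /WE hy]; apply/WE => i j; first exact: linear0.
    by rewrite linearP hx hy scaler0 addr0.
  apply/WE => i j; have := gl_matrix_eval_comm hrep A q i j u.
  rewrite hu linear0 !big1 => [|k _|k _]; rewrite ?hu ?scaler0 //.
  by rewrite addr0 subr0.
have WT := gen W hW; apply/matrixP => i j; apply: endoP => u.
have /WE -> : u \in W.
  by rewrite WT //; apply/WE/gl_matrix_eval_hwv_eq0 => // k; exact: diag0.
by rewrite mxE.
Qed.

(** By [gl_matrix_eval_eq0] the polynomials killing [E] are the multiples of this product, so it is
    the only monic one of least size. *)
Lemma gl_minimal_polynomialP q :
  gl_minimal_polynomial rho q <-> q = \prod_(a <- shuffle_ends l) ('X - a%:P).
Proof.
set Q := \prod_(a <- _) _.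
have Qm : Q \is monic by exact: monic_prod_XsubC.
have MQ : M Q = 0.
  by apply/gl_matrix_eval_eq0 => [|a]; rewrite ?monic_neq0 // mup_prod_XsubC.
have Qdvd p : p \is monic -> M p = 0 -> Q %| p.
  by move=> /monic_neq0 p0 Mp; apply: prod_XsubC_dvdp => //; apply/gl_matrix_eval_eq0.
split=> [[qm Mq qmin]|->].
  apply/eqP; rewrite -eqp_monic // eqp_sym -dvdp_size_eqp ?Qdvd //.
  by rewrite eqn_leq qmin // dvdp_leq ?Qdvd ?monic_neq0.
split=> // p pm Mp; rewrite dvdp_leq ?Qdvd //; exact: monic_neq0.
Qed.

End MinimalPolynomial.

Theorem theorem4p15 (R : realType) (n : nat) (hn : (1 <= n)%N)
    (lambda : 'I_n -> R[i]) (V : lmodType R[i])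
    (rho : {linear 'M[R[i]]_n -> endo V})
    (hL : simple_highest_weight rho lambda) :
  (exists q : {poly R[i]}, gl_minimal_polynomial rho q) /\
  (forall q : {poly R[i]}, gl_minimal_polynomial rho q ->
     root_multiset q (shuffle_ends (shifted_weight lambda))).
Proof.
split=> [|q /(gl_minimal_polynomialP hL) -> a]; last exact: mup_prod_XsubC.
by exists (\prod_(a <- shuffle_ends (shifted_weight lambda)) ('X - a%:P));
  apply/(gl_minimal_polynomialP hL).
Qed.
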